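(* Let $K\in\mathcal{K}^2$ be in Behrend-bisecting position. Then $$\frac{\mathrm{A}(K)}{\mathrm{D}_B(K)^2}\geq\frac{\sqrt{3}}{4}.$$
   Context: $\mathcal{K}^2$ is the family of planar convex bodies (compact convex subsets of $\mathbb{R}^2$) with non-empty interior. For a compact set $S\subset\mathbb{R}^2$, $\mathrm{A}(S)$ is its area (2-dimensional Lebesgue measure) and $\mathrm{D}(S)$ its diameter (largest Euclidean distance between two points of $S$). A bisection of $K\in\mathcal{K}^2$ is a pair of closed sets $(K_1,K_2)$ such that (i) $K=K_1\cup K_2$, and (ii) $K_1\cap K_2=l([-1,1])$, where $l:[-1,1]\to K$ is an injective continuous curve whose endpoints $l(-1),l(1)$ are the only points of the curve lying in the boundary of $K$. $\mathcal{B}(K)$ is the set of all bisections of $K$, and $\mathrm{D}_B(K)=\inf_{(K_1,K_2)\in\mathcal{B}(K)}\max\{\mathrm{D}(K_1),\mathrm{D}(K_2)\}$. A set $K\in\mathcal{K}^2$ is in Behrend-bisecting position if $$\frac{\mathrm{A}(K)}{\mathrm{D}_B(K)^2}=\sup_{\phi}\frac{\mathrm{A}(\phi(K))}{\mathrm{D}_B(\phi(K))^2},$$ where $\phi$ ranges over all nonsingular affine maps $\phi:\mathbb{R}^2\to\mathbb{R}^2$. *)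

(* Defs.v *)
From mathcomp Require Import all_boot all_order all_algebra.
From mathcomp Require Import all_classical all_reals all_analysis.

Set Implicit Arguments.
Unset Strict Implicit.
Unset Printing Implicit Defensive.

Import Order.TTheory GRing.Theory Num.Theory.
Import numFieldNormedType.Exports.

Local Open Scope classical_set_scope.
Local Open Scope ring_scope.

(** The plane is [R * R]. Its library norm is the sup norm, which induces the
    usual topology, but the Euclidean distance has to be defined. *)
Definition edist {R : realType} (p q : R * R) : R :=
  Num.sqrt ((p.1 - q.1) ^+ 2 + (p.2 - q.2) ^+ 2).

Definition diameter {R : realType} (S : set (R * R)) : R :=
  sup [set edist p q | p in S & q in S].

Definition area {R : realType} (S : set (R * R)) : R :=
  fine ((@lebesgue_measure R \x @lebesgue_measure R)%E S).

Definition boundary {T : topologicalType} (S : set T) : set T :=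
  closure S `\` interior S.

Definition planar_convex_body {R : realType} (K : set (R * R)) : Prop :=
  [/\ compact K, @convex_set R (R^o * R^o)%type K & interior K !=set0].

Definition is_bisection {R : realType} (K K1 K2 : set (R * R)) : Prop :=
  [/\ closed K1, closed K2, K = K1 `|` K2 &
      exists l : R -> R * R,
        [/\ {within `[-1, 1], continuous l},
            set_inj `[-1, 1] l,
            l @` `[-1, 1] `<=` K,
            forall t, -1 <= t <= 1 -> (boundary K (l t) <-> t = -1 \/ t = 1) &
            K1 `&` K2 = l @` `[-1, 1]]].

Definition bisecting_diameter {R : realType} (K : set (R * R)) : R :=
  inf [set d | exists K1 K2, is_bisection K K1 K2 /\
                             d = Num.max (diameter K1) (diameter K2)].

Definition bisecting_ratio {R : realType} (K : set (R * R)) : R :=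
  area K / bisecting_diameter K ^+ 2.

Definition nonsingular_affine {R : realType} (phi : R * R -> R * R) : Prop :=
  exists (M : 'M[R]_2) (b : R * R), M \in unitmx /\
    forall p, phi p = (M 0 0 * p.1 + M 0 1 * p.2 + b.1,
                       M 1 0 * p.1 + M 1 1 * p.2 + b.2).

(** The supremum is taken in [\bar R], as the real [sup] of an unbounded set
    is a default value. *)
Definition behrend_bisecting_position {R : realType} (K : set (R * R)) : Prop :=
  (bisecting_ratio K)%:E =
  ereal_sup [set (bisecting_ratio (phi @` K))%:E | phi in @nonsingular_affine R].

(* Main.v *)
(** Let [p], [q] be a diametral pair of [K] and consider the rectangle
    circumscribed about [K] with two sides parallel to [pq]: its other two sides
    pass through [p] and [q].  The convex hull of [p], [q] and the two points
    where [K] touches the sides parallel to [pq] has half the area of this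
    rectangle.  An affine map makes the rectangle a [1 * 2] rectangle with long
    side along the image of [pq]; the image [L] of [K] then has area at least 1,
    and the line halving the long sides cuts [L] into two pieces contained in
    unit squares, so that [bisecting_diameter L <= sqrt 2].  Hence the ratio of
    [L] is at least [1 / 2 > sqrt 3 / 4], and that of [K] is at least as large. *)
Require Import Defs.
From mathcomp Require Import all_boot all_order all_algebra.
From mathcomp Require Import all_classical all_reals all_analysis.
From mathcomp Require Import measurable_realfun ring lra.
Import Defs.
Import Order.TTheory GRing.Theory Num.Theory.
Import numFieldNormedType.Exports.
Local Open Scope classical_set_scope.
Local Open Scope ring_scope.

Set Implicit Arguments.
Unset Strict Implicit.
Unset Printing Implicit Defensive.

(** * Continuity, convexity and measurability in the plane *)

Lemma pair_continuous (T U V : topologicalType) (f : T -> U) (g : T -> V) :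
  continuous f -> continuous g -> continuous (fun x => (f x, g x)).
Proof. by move=> cf cg x; apply: (cvg_pair (cf x) (cg x)). Qed.

Lemma convex_set_comb (R : realType) (K : set (R * R)) :
  @convex_set R (R^o * R^o)%type K ->
  forall p q s t, 0 <= s -> 0 <= t -> s + t = 1 -> K p -> K q ->
  K (s * p.1 + t * q.1, s * p.2 + t * q.2).
Proof.
move=> cK p q s t s0 t0 st1 Kp Kq.
have s1 : s <= 1 by lra.
have /set_mem := cK p q (Itv01 s0 s1) (mem_set Kp) (mem_set Kq).
have -> : t = 1 - s by lra.
by case: p {Kp} => p1 p2; case: q {Kq} => q1 q2.
Qed.

(** An open set is the union of the boxes with rational corners that it contains, a countable union
    of measurable rectangles. This links the product topology to the product sigma-algebra. *)
Lemma open_measurable_prod (R : realType) (U : set (R * R)) :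
  open U -> measurable U.
Proof.
move=> oU.
pose box (i : (rat * rat) * (rat * rat)) : set (R * R) :=
  `]ratr i.1.1, ratr i.1.2[ `*` `]ratr i.2.1, ratr i.2.2[.
have rat_between (x y : R) : x < y -> exists a : rat, x < ratr a < y.
  by move=> /rat_in_itvoo[a]; rewrite in_itv/=; exists a.
have -> : U = \bigcup_i (if `[< box i `<=` U >] then box i else set0).
  apply/seteqP; split => [p Up|p [i _]]; last first.
    by case: asboolP => // + ip; exact.
  have /nbhs_ballP[e /= e0 eU] : nbhs p U by exact: open_nbhs_nbhs.
  have [a /andP[a1 a2]] : exists a : rat, p.1 - e < ratr a < p.1.
    by apply: rat_between; lra.
  have [b /andP[b1 b2]] : exists a : rat, p.1 < ratr a < p.1 + e.
    by apply: rat_between; lra.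
  have [c /andP[c1 c2]] : exists a : rat, p.2 - e < ratr a < p.2.
    by apply: rat_between; lra.
  have [d /andP[d1 d2]] : exists a : rat, p.2 < ratr a < p.2 + e.
    by apply: rat_between; lra.
  exists ((a, b), (c, d)) => //; rewrite asboolT.
    by split; rewrite /= in_itv/=; apply/andP.
  move=> [x y] [] /=; rewrite !in_itv/= => /andP[x1 x2] /andP[y1 y2].
  by apply: eU; split; rewrite -ball_normE /= ltr_norml; lra.
apply: countable_bigcupT_measurable => // i.
by case: ifP => // _; apply: measurableX.
Qed.

Lemma compact_measurable_prod (R : realType) (L : set (R * R)) :
  compact L -> measurable L.
Proof.
move=> cL; rewrite -(setCK L); apply: measurableC; apply: open_measurable_prod.
rewrite openC; apply: compact_closed cL.
exact: norm_hausdorff.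
Qed.

(** * Lower bound for the area by vertical sections *)

(** Convexity in coordinates, with plain real weights in place of the bundled ones of
    [convex_set]. *)
Definition comb_closed {R : realType} (L : set (R * R)) : Prop :=
  forall p q s t, 0 <= s -> 0 <= t -> s + t = 1 -> L p -> L q ->
  L (s * p.1 + t * q.1, s * p.2 + t * q.2).

(** The triangle on (0, 0), (0, 2), (h, a) lies in [L], and its section at abscissa [t * h] is the
    segment from [t * a] to [t * a + 2 * (1 - t)]. The sign of [h] is free, so triangles on both
    sides of the axis are covered. *)
Lemma triangle_xsection_ge (R : realType) (L : set (R * R)) (h a t : R) :
  measurable L -> comb_closed L -> L (0, 0) -> L (0, 2) -> L (h, a) ->
  0 <= t <= 1 ->
  ((2 * (1 - t))%R%:E <= lebesgue_measure (xsection L (t * h)%R))%E.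
Proof.
move=> mL cL L0 L2 La /andP[t0 t1].
have -> : (2 * (1 - t))%:E =
    lebesgue_measure (`[t * a, t * a + 2 * (1 - t)]%classic : set R).
  rewrite lebesgue_measure_itv/= lte_fin; case: ifPn => h1.
    by rewrite -EFinB; congr EFin; ring.
  by congr EFin; move: h1; rewrite -leNgt; lra.
apply: le_measure; rewrite ?inE//; first exact: measurable_xsection.
move=> y /=; rewrite in_itv/= => /andP[y1 y2]; apply/mem_set => /=.
(* At [t = 1] the segment is the apex alone, and [w] below would divide by 0. *)
have [t1'|t1'] := eqVneq t 1.
  suff -> : y = a by rewrite t1' mul1r.
  by move: y1 y2; rewrite t1'; lra.
have t1p : 0 < 1 - t by rewrite subr_gt0 lt_neqAle t1'.
(* The line from the apex through [(t * h, y)] meets the axis at height [w]. *)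
pose w := (y - t * a) / (1 - t).
have wy : w * (1 - t) = y - t * a by rewrite /w divfK// gt_eqF.
have w0 : 0 <= w by rewrite divr_ge0//; lra.
have w2 : w <= 2 by rewrite /w ler_pdivrMr//; lra.
have Lw : L (0, w).
  have -> : (0, w) = ((1 - w / 2) * 0 + w / 2 * 0, (1 - w / 2) * 0 + w / 2 * 2).
    by congr pair; field.
  by apply: (cL (0, 0) (0, 2)) => //; lra.
have -> : (t * h, y) = (t * h + (1 - t) * 0, t * a + (1 - t) * w).
  by congr pair; lra.
by apply: (cL (h, a) (0, w)) => //; lra.
Qed.

Lemma integral_affine (R : realType) (k a b : R) : a < b ->
  (\int[lebesgue_measure]_(x in `[a, b]) (2 * (1 - x / k))%:E =
  ((2 * b - b ^+ 2 / k) - (2 * a - a ^+ 2 / k))%:E)%E.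
Proof.
move=> ab; pose F (x : R) : R := 2 * x - x ^+ 2 / k.
have dF (x : R) : is_derive x (1 : R) F (2 * (1 - x / k)).
  apply: is_derive_eq.
  rewrite /GRing.scale /=; ring.
have cF : continuous F.
  by move=> x; apply/differentiable_continuous/derivable1_diffP.
rewrite (@continuous_FTC2 _ _ F)//.
- apply: continuous_subspaceT => x.
  apply: cvgM; first exact: cvg_cst.
  apply: cvgB; first exact: cvg_cst.
  by apply: cvgM; [exact: cvg_id | exact: cvg_cst].
- split.
  + by move=> x _; apply: ex_derive.
  + exact/cvg_at_right_filter/cF.
  + exact/cvg_at_left_filter/cF.
- by move=> x _; rewrite derive1E; apply: derive_val.
Qed.

(** Integrates the section bound with [t = x / k]; the last hypothesis places [[u, v]] between the
    axis and the apex, on either side. *)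
Lemma triangle_integral_ge (R : realType) (L : set (R * R)) (k a u v : R) :
  measurable L -> comb_closed L -> L (0, 0) -> L (0, 2) -> L (k, a) ->
  k != 0 -> u < v -> (forall x, u <= x <= v -> 0 <= x / k <= 1) ->
  (((2 * v - v ^+ 2 / k) - (2 * u - u ^+ 2 / k))%:E <=
    \int[lebesgue_measure]_(x in `[u, v]) lebesgue_measure (xsection L x))%E.
Proof.
move=> mL cL L0 L2 La k0 uv xk; rewrite -integral_affine//.
apply: ge0_le_integral => //.
- move=> x /=; rewrite in_itv/= => /xk /andP[_ x1].
  by rewrite lee_fin; lra.
- apply/measurable_EFinP; apply: measurable_funM => //.
  apply: measurable_funB => //; exact: measurable_funM.
- apply: measurable_funTS; exact: (@measurable_fun_xsection _ _ _ _ R lebesgue_measure).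
- move=> x; rewrite /= in_itv/= => /xk xk1.
  by have := triangle_xsection_ge mL cL L0 L2 La xk1; rewrite divfK.
Qed.

(** The axis from (0, 0) to (0, 2) is a common base of length 2 of two triangles with apexes at
    abscissas [c] and [c + 1]. Their areas are [- c] and [c + 1], with sum 1. *)
Lemma area_ge1 (R : realType) (L : set (R * R)) (c a b : R) :
  compact L -> comb_closed L -> L (0, 0) -> L (0, 2) ->
  L (c, a) -> L (c + 1, b) -> L `<=` `[c, c + 1] `*` `[0, 2] ->
  1 <= area L.
Proof.
move=> /compact_measurable_prod mL cL L0 L2 La Lb Lsub.
have [] := Lsub _ L0; rewrite /= !in_itv/= => /andP[c0 c1] _.
pose mu := @lebesgue_measure R.
(* Finiteness matters because [fine] sends an infinite measure to 0. *)
have muL : ((mu \x mu) L < +oo)%E.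
  apply: (@le_lt_trans _ _ ((mu \x mu)%E (`[c, c + 1] `*` `[0, 2]))).
    by apply: le_measure; rewrite ?inE//; exact: measurableX.
  rewrite product_measure1E//= !lebesgue_measure_itv/= !lte_fin.
  by case: ifP => _; case: ifP => _; rewrite -?EFinB ?mule0 ?mul0e// -EFinM ltry.
rewrite /area -lee_fin fineK; last by rewrite ge0_fin_numE.
rewrite -/mu; set G := fun x => mu (xsection L x).
have mG : measurable_fun setT G by exact: measurable_fun_xsection.
have mG' (D : set R) : measurable_fun D G by exact: measurable_funTS.
have G0 x : (0 <= G x)%E by exact: measure_ge0.
pose D : set R := `[c, c + 1]%classic.
(* The left interval is open at 0 to make the pieces disjoint; its end point is restored below as a
   null set. *)
have DE : D = `[c, 0[%classic `|` `[0, c + 1]%classic.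
  apply/seteqP; split=> x; rewrite /D /= !in_itv/=; last by case=> /andP[]; lra.
  by case: (ltP x 0) => x0 /andP[x1 x2]; [left|right]; lra.
(* The product measure is by definition the integral of [G] over the whole line. *)
apply: (@le_trans _ _ (\int[mu]_(x in D) G x)%E); last first.
  by apply: ge0_subset_integral => //; exact: measurable_itv.
rewrite DE ge0_integral_setU//; first last.
- apply/disj_set2P/seteqP; split=> x//= [].
  by rewrite !in_itv/= => /andP[_ x0] /andP[x1 _]; lra.
- exact: mG'.
rewrite integral_itv_bndo_bndc//.
have -> : 1%:E = ((- c)%:E + (c + 1)%:E)%E :> \bar R by rewrite -EFinD; congr EFin; ring.
apply: leeD.
  (* For [c = 0] the left triangle is degenerate and contributes 0. *)
  have [->|cn0] := eqVneq c 0; first by rewrite oppr0; exact: integral_ge0.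
  have c_lt0 : c < 0 by rewrite lt_neqAle cn0.
  have -> : - c = (2 * 0 - 0 ^+ 2 / c) - (2 * c - c ^+ 2 / c) by field.
  apply: (triangle_integral_ge mL cL L0 L2 La) => // x /andP[x1 x2].
  by rewrite ler_ndivrMr// ler_ndivlMr//; lra.
have [->|cn0] := eqVneq (c + 1) 0; first exact: integral_ge0.
have c_gt0 : 0 < c + 1 by rewrite lt_neqAle eq_sym cn0.
apply: le_trans (triangle_integral_ge mL cL L0 L2 Lb cn0 c_gt0 _) => [|x].
  by rewrite lee_fin le_eqVlt; apply/orP; left; apply/eqP; field.
by move=> /andP[x1 x2]; rewrite ler_pdivrMr// ler_pdivlMr//; lra.
Qed.

(** * The cut along the line at height 1 *)

(** Near [(x, 1)], every point lies on a segment joining a point of the chord from [(x0, 1)] to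
    [(x1, 1)] to an end of the axis: (0, 0) for points below the chord, (0, 2) for those above. *)
Lemma affine_midline_interior (R : realType) (L : set (R * R)) (x0 x1 x : R) :
  comb_closed L -> L (0, 0) -> L (0, 2) -> L (x0, 1) -> L (x1, 1) ->
  -1 <= x0 <= 0 -> 0 <= x1 <= 1 -> x0 < x < x1 -> interior L (x, 1).
Proof.
move=> cL L0 L2 Lx0 Lx1 /andP[x0l x0u] /andP[x1l x1u] /andP[xx0 xx1].
(* Half of each gap absorbs the shift from [x] to [u], the other half the division by [s >= 1 - e],
   since [x0] and [x1] have absolute value at most 1. The bound [1 / 2] keeps [s] away from 0. *)
have [e [e0 e1 e2 e3]] : exists e : R,
    [/\ 0 < e, e <= (x - x0) / 2, e <= (x1 - x) / 2 & e <= 1 / 2].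
  exists (Num.min ((x - x0) / 2) (Num.min ((x1 - x) / 2) (1 / 2))).
  by split; rewrite ?lt_min ?ge_min ?lexx ?orbT//; lra.
apply/nbhs_ballP; exists e => // -[u v] [] /=.
rewrite -!ball_normE /= !ltr_norml => ux vy.
have Lmid w : x0 <= w <= x1 -> L (w, 1).
  move=> wx; pose t := (w - x0) / (x1 - x0).
  have t0 : 0 <= t by rewrite divr_ge0//; lra.
  have t1 : t <= 1 by rewrite ler_pdivrMr//; lra.
  have -> : (w, 1) = ((1 - t) * x0 + t * x1, (1 - t) * 1 + t * 1) :> R * R.
    by congr pair; [rewrite /t; field; lra | ring].
  by apply: (cL (x0, 1) (x1, 1)) => //; lra.
have cone s y : 1 / 2 <= s -> 1 - e <= s -> s <= 1 -> L (0, y) ->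
    L (u, s * 1 + (1 - s) * y).
  move=> sh se s1 Ly.
  have s0 : s != 0 by lra.
  have Lu : L (u / s, 1).
    apply: Lmid; rewrite ler_pdivlMr ?ler_pdivrMr; try lra.
    apply/andP; split; nra.
  have -> : u = s * (u / s) + (1 - s) * 0 by field.
  by apply: (cL (u / s, 1) (0, y)) => //; lra.
have [v1|v1] := leP v 1.
  have -> : v = v * 1 + (1 - v) * 0 by ring.
  by apply: cone => //; lra.
have -> : v = (2 - v) * 1 + (1 - (2 - v)) * 2 by ring.
by apply: cone => //; lra.
Qed.

Lemma fst_continuous (T U : topologicalType) : continuous (@fst T U).
Proof. by move=> p; exact: cvg_fst. Qed.

Lemma snd_continuous (T U : topologicalType) : continuous (@snd T U).
Proof. by move=> p; exact: cvg_snd. Qed.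

Lemma halfplane_le_closed (R : realType) (r : R) :
  closed [set p : R * R | p.2 <= r].
Proof.
have /continuous_closedP/(_ _ (@closed_le _ r)) := @snd_continuous R R.
exact.
Qed.

Lemma halfplane_ge_closed (R : realType) (r : R) :
  closed [set p : R * R | r <= p.2].
Proof.
have /continuous_closedP/(_ _ (@closed_ge _ r)) := @snd_continuous R R.
exact.
Qed.

(** The cutting curve is the whole chord of [L] at height 1. Its relative interior is interior to
    [L], and its ends, being extreme in the chord, are on the boundary. *)
Lemma cut_is_bisection (R : realType) (L : set (R * R)) (c a b : R) :
  compact L -> comb_closed L -> L (0, 0) -> L (0, 2) ->
  L (c, a) -> L (c + 1, b) -> L `<=` `[c, c + 1] `*` `[0, 2] ->
  is_bisection L (L `&` [set p | p.2 <= 1]) (L `&` [set p | 1 <= p.2]).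
Proof.
move=> kL cL L0 L2 La Lb Lsub.
have clL : closed L by exact: (compact_closed (@norm_hausdorff _ _)).
have box p : L p -> [/\ c <= p.1, p.1 <= c + 1, 0 <= p.2 & p.2 <= 2].
  by move=> /Lsub[]; rewrite /= !in_itv/= => /andP[? ?] /andP[? ?].
have [/= c0 c1 _ _] := box _ L0.
have L1 : L (0, 1).
  have -> : (0, 1) = (1 / 2 * 0 + 1 / 2 * 0, 1 / 2 * 0 + 1 / 2 * 2) :> R * R.
    by congr pair; field.
  by apply: (cL (0, 0) (0, 2)) => //; lra.
(* A point of [L] off the axis, joined to the far endpoint of the axis,
   crosses the line at a point off the axis on the same side. *)
have cross h y : L (h, y) -> exists2 r, 1 / 2 <= r & L (r * h, 1).
  move=> Lh; have [/= _ _ y0 y2] := box _ Lh.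
  have [y1|y1] := leP y 1.
    exists (1 / (2 - y)); first by rewrite ler_pdivlMr; lra.
    have -> : (1 / (2 - y) * h, 1) = (1 / (2 - y) * h + (1 - 1 / (2 - y)) * 0,
        1 / (2 - y) * y + (1 - 1 / (2 - y)) * 2).
      by congr pair; field; lra.
    have r1 : 1 / (2 - y) <= 1 by rewrite ler_pdivrMr; lra.
    have r0 : 0 <= 1 / (2 - y) by rewrite divr_ge0//; lra.
    by apply: (cL (h, y) (0, 2)) => //; lra.
  exists (1 / y); first by rewrite ler_pdivlMr; lra.
  have -> : (1 / y * h, 1) = (1 / y * h + (1 - 1 / y) * 0,
      1 / y * y + (1 - 1 / y) * 0).
    by congr pair; field; lra.
  have r1 : 1 / y <= 1 by rewrite ler_pdivrMr; lra.
  have r0 : 0 <= 1 / y by rewrite divr_ge0//; lra.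
  by apply: (cL (h, y) (0, 0)) => //; lra.
(* Compactness of the chord [M] provides its extreme abscissas [x0] and [x1]. *)
pose M := L `&` ([set p | p.2 <= 1] `&` [set p | 1 <= p.2]).
have MP x y : M (x, y) <-> L (x, y) /\ y = 1.
  split=> [[Lxy [/= y1 y2]]|[Lxy y1]].
    by split => //; apply/eqP; rewrite eq_le y1 y2.
  by split => //; rewrite /= y1 lexx.
have kM : compact M.
  apply: compact_closedI => //; apply: closedI.
    exact: halfplane_le_closed.
  exact: halfplane_ge_closed.
have M0 : M !=set0 by exists (0, 1); split => //=.
have cfst : {within M, continuous (fun p : R * R => p.1)}.
  by apply: continuous_subspaceT; exact: fst_continuous.
have [[x0 y0] /set_mem/MP[Lx0 y01] x0min] := compact_EVT_min M0 kM cfst.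
rewrite {}y01 in Lx0 x0min.
have [[x1 y1] /set_mem/MP[Lx1 y11] x1max] := compact_EVT_max M0 kM cfst.
rewrite {}y11 in Lx1 x1max.
have {}x0min x : L (x, 1) -> x0 <= x.
  by move=> Lx; apply: (x0min (x, 1)); apply/mem_set/MP.
have {}x1max x : L (x, 1) -> x <= x1.
  by move=> Lx; apply: (x1max (x, 1)); apply/mem_set/MP.
have x00 := x0min _ L1; have x10 := x1max _ L1.
have [/= cx0 _ _ _] := box _ Lx0; have [/= _ cx1 _ _] := box _ Lx1.
have x01 : x0 < x1.
  (* The box has width 1, so one of its vertical sides is off the axis; [cross] carries the contact
     point on that side to a chord point off the axis. *)
  have [c_neg|c_pos] : c < 0 \/ 0 < c + 1 by lra.
    have [r r0 /x0min] := cross _ _ La; nra.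
  have [r r0 /x1max] := cross _ _ Lb; nra.
split.
- by apply: closedI => //; exact: halfplane_le_closed.
- by apply: closedI => //; exact: halfplane_ge_closed.
- rewrite -setIUr; apply/esym/setIidPl => p _ /=.
  by case: (leP p.2 1) => [|/ltW]; [left | right].
pose l (t : R) : R * R := ((x0 + x1) / 2 + t * ((x1 - x0) / 2), 1).
have Lmid t : -1 < t -> t < 1 -> interior L (l t).
  move=> t0 t1; apply: (affine_midline_interior cL L0 L2 Lx0 Lx1); try lra.
  by apply/andP; split; nra.
have l0 : l (-1) = (x0, 1) by congr pair; field.
have l1 : l 1 = (x1, 1) by congr pair; field.
have Ll t : -1 <= t <= 1 -> L (l t).
  move=> /andP[]; rewrite le_eqVlt => /predU1P[<-|t0]; first by rewrite l0.
  rewrite le_eqVlt => /predU1P[->|t1]; first by rewrite l1.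
  exact: (nbhs_singleton (Lmid t t0 t1)).
exists l; split.
- apply: continuous_subspaceT; apply: pair_continuous => t; last exact: cvg_cst.
  apply: cvgD; first exact: cvg_cst.
  by apply: cvgM; [exact: cvg_id | exact: cvg_cst].
- by move=> s t _ _ [] => st; nra.
- by move=> _ [t /= t01 <-]; apply: Ll; rewrite in_itv/= in t01.
- move=> t t01; split.
    move=> [_ nint]; have /andP[] := t01.
    rewrite le_eqVlt => /predU1P[<-|t0]; first by left.
    rewrite le_eqVlt => /predU1P[->|t1]; first by right.
    by case: nint; exact: Lmid.
  move=> tE; split; first by apply: subset_closure; exact: Ll.
  (* A ball inside [L] around an end of the chord would contain a chord point beyond that end. *)
  move=> /nbhs_ballP[e /= e0 eL].
  case: tE => tE.
    have : L (x0 - e / 2, 1).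
      by apply: eL; rewrite tE l0; split; rewrite -ball_normE /= ltr_norml; lra.
    by move=> /x0min; lra.
  have : L (x1 + e / 2, 1).
    by apply: eL; rewrite tE l1; split; rewrite -ball_normE /= ltr_norml; lra.
  by move=> /x1max; lra.
rewrite setIACA setIid -/M; apply/seteqP; split => [[x y] /MP[Lx yE]|].
  rewrite {}yE in Lx *; have h0 := x0min _ Lx; have h1 := x1max _ Lx.
  exists ((2 * x - x0 - x1) / (x1 - x0)).
    by rewrite /= in_itv/= ler_pdivlMr ?ler_pdivrMr; lra.
  by congr pair; field; lra.
move=> _ [t /= t01 <-]; apply/MP; split => //.
by apply: Ll; rewrite in_itv/= in t01.
Qed.

(** * Diameters, bisecting diameter and bisecting ratio *)

Lemma edist_le (R : realType) (p q : R * R) (d : R) :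
  0 <= d -> (p.1 - q.1) ^+ 2 + (p.2 - q.2) ^+ 2 <= d ^+ 2 -> edist p q <= d.
Proof. by move=> d0 h; rewrite -[leRHS]ger0_norm// -sqrtr_sqr ler_wsqrtr. Qed.

Lemma ler_edist_snd (R : realType) (p q : R * R) : `|p.2 - q.2| <= edist p q.
Proof. by rewrite -sqrtr_sqr ler_wsqrtr// lerDr sqr_ge0. Qed.

Lemma diameter_le (R : realType) (S : set (R * R)) (d : R) :
  0 <= d -> (forall p q, S p -> S q -> edist p q <= d) -> diameter S <= d.
Proof.
(* The empty set has diameter 0, the default value of [sup], which [0 <= d] covers. *)
move=> d0 Sd; have [->|/set0P[p Sp]] := eqVneq S set0.
  by rewrite /diameter image2E setX0 image_set0 sup0.
apply: ge_sup; last by move=> _ [p' Sp' [q Sq <-]]; exact: Sd.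
by exists (edist p p); exists p => //; exists p.
Qed.

(** The bound [d] ensures that the supremum is taken over a bounded set and is not a default
    value. *)
Lemma edist_le_diameter (R : realType) (S : set (R * R)) (d : R) (p q : R * R) :
  (forall p q, S p -> S q -> edist p q <= d) -> S p -> S q ->
  edist p q <= diameter S.
Proof.
move=> Sd Sp Sq; apply: ub_le_sup; last by exists p => //; exists q.
by exists d => _ [p' Sp' [q' Sq' <-]]; exact: Sd.
Qed.

Lemma diameter_ge0 (R : realType) (S : set (R * R)) : 0 <= diameter S.
Proof.
rewrite /diameter; set D := (X in sup X).
have [hD|/sup_out->//] := pselect (has_sup D).
have [[d Dd] ubD] := hD; apply: le_trans (ub_le_sup ubD Dd).
by case: Dd => p _ [q _ <-]; exact: sqrtr_ge0.
Qed.

Lemma bisecting_diameter_le (R : realType) (L K1 K2 : set (R * R)) (d : R) :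
  is_bisection L K1 K2 -> diameter K1 <= d -> diameter K2 <= d ->
  bisecting_diameter L <= d.
Proof.
move=> LK K1d K2d; apply: (@le_trans _ _ (Num.max (diameter K1) (diameter K2))).
  apply: ge_inf; last by exists K1, K2.
  by exists 0 => _ [K1' [K2' [_ ->]]]; rewrite le_max diameter_ge0.
by rewrite ge_max K1d.
Qed.

(* The two pieces share a point of the curve, and one of [p], [q] is at distance
   at least [d] from it. *)
Lemma bisecting_diameter_ge (R : realType) (L K1 K2 : set (R * R)) (d D : R)
    (p q : R * R) :
  is_bisection L K1 K2 -> (forall p q, L p -> L q -> edist p q <= D) ->
  L p -> L q -> p.2 + 2 * d <= q.2 -> d <= bisecting_diameter L.
Proof.
(* The given bisection shows that the infimum is over a nonempty set. *)
move=> LK LD Lp Lq pq; apply: lb_le_inf; first by eexists; exists K1, K2.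
move=> _ [K1' [K2' [[_ _ LE [l [_ _ lL _ lE]]] ->]]] {K1 K2 LK}.
have [K1L K2L] : K1' `<=` L /\ K2' `<=` L by rewrite LE; split=> r; [left|right].
have [K1l K2l] : (K1' `&` K2') (l 0).
  by rewrite lE; exists 0 => //=; rewrite in_itv/=; apply/andP; split; lra.
have far r : L r -> d <= `|r.2 - (l 0).2| ->
    d <= Num.max (diameter K1') (diameter K2').
  move=> Lr /le_trans/(_ (ler_edist_snd _ _)) rl; rewrite le_max.
  have : (K1' `|` K2') r by rewrite -LE.
  case=> Kr; apply/orP; [left|right]; apply: (le_trans rl);
    apply: (@edist_le_diameter _ _ D) => // p' q' Kp' Kq'; apply: LD; auto.
have [l2|l2] := leP (l 0).2 (p.2 + d); [apply: (far _ Lq)|apply: (far _ Lp)].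
  by rewrite ler_normr; apply/orP; left; lra.
by rewrite ler_normr; apply/orP; right; lra.
Qed.

(** The area is at least 1, and each half of the cut lies in a unit square, so the squared bisecting
    diameter is at most 2. *)
Lemma bisecting_ratio_ge (R : realType) (L : set (R * R)) (c a b : R) :
  compact L -> comb_closed L -> L (0, 0) -> L (0, 2) ->
  L (c, a) -> L (c + 1, b) -> L `<=` `[c, c + 1] `*` `[0, 2] ->
  1 / 2 <= bisecting_ratio L.
Proof.
move=> kL cL L0 L2 La Lb Lsub.
have box p : L p -> [/\ c <= p.1, p.1 <= c + 1, 0 <= p.2 & p.2 <= 2].
  by move=> /Lsub[]; rewrite /= !in_itv/= => /andP[? ?] /andP[? ?].
have LB := cut_is_bisection kL cL L0 L2 La Lb Lsub.
have A1 := area_ge1 kL cL L0 L2 La Lb Lsub.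
(* Positivity of the denominator, from two points 2 apart in height; 3 is a crude bound for the
   diameter of a 1 by 2 box. *)
have D1 : 1 <= bisecting_diameter L.
  apply: (@bisecting_diameter_ge _ _ _ _ 1 3 (0, 0) (0, 2) LB) => [p q| | |] //=;
    last lra.
  by move=> /box[? ? ? ?] /box[? ? ? ?]; apply: edist_le => //; nra.
have D2 : bisecting_diameter L <= Num.sqrt 2.
  by apply: (bisecting_diameter_le LB); apply: diameter_le; rewrite ?sqrtr_ge0//;
    move=> p q [/box[? ? ? ?] /= ?] [/box[? ? ? ?] /= ?];
    apply: edist_le; rewrite ?sqrtr_ge0// sqr_sqrtr//; nra.
have DD : bisecting_diameter L ^+ 2 <= 2.
  rewrite -[leRHS]sqr_sqrtr// ler_sqr ?nnegrE ?sqrtr_ge0//; lra.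
rewrite /bisecting_ratio ler_pdivlMr; first by lra.
by rewrite exprn_gt0//; lra.
Qed.

(** * Affine maps and the normal position *)

Lemma det_mx22 (F : comPzRingType) (M : 'M[F]_2) :
  \det M = M 0 0 * M 1 1 - M 0 1 * M 1 0.
Proof.
rewrite (expand_det_row _ 0) !big_ord_recl big_ord0 /cofactor !det_mx11 !mxE /=.
rewrite addr0 expr0 mul1r expr1 mulN1r mulrN.
by congr (M _ _ * M _ _ - M _ _ * M _ _); apply/val_inj.
Qed.

Lemma nonsingular_affineP (R : realType) (m00 m01 m10 m11 b1 b2 : R)
    (phi : R * R -> R * R) :
  m00 * m11 - m01 * m10 != 0 ->
  (forall p, phi p = (m00 * p.1 + m01 * p.2 + b1, m10 * p.1 + m11 * p.2 + b2)) ->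
  nonsingular_affine phi.
Proof.
move=> det0 phiE.
exists (\matrix_(i < 2, j < 2) if i == 0 then (if j == 0 then m00 else m01)
                              else (if j == 0 then m10 else m11)), (b1, b2).
by split=> [|p]; rewrite ?unitmxE ?det_mx22 ?unitfE !mxE.
Qed.

Lemma comb_closed_affine_image (R : realType) (K : set (R * R))
    (phi : R * R -> R * R) :
  nonsingular_affine phi -> comb_closed K -> comb_closed (phi @` K).
Proof.
move=> [M [b [_ phiE]]] cK _ _ s t s0 t0 st1 [p Kp <-] [q Kq <-].
exists (s * p.1 + t * q.1, s * p.2 + t * q.2); first exact: cK.
have -> : t = 1 - s by lra.
by rewrite !phiE /=; congr pair; ring.
Qed.

Lemma nonsingular_affine_continuous (R : realType) (phi : R * R -> R * R) :
  nonsingular_affine phi -> continuous phi.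
Proof.
move=> [M [b [_ phiE]]].
have {phiE}-> : phi = fun p => (M 0 0 * p.1 + M 0 1 * p.2 + b.1,
    M 1 0 * p.1 + M 1 1 * p.2 + b.2) by apply/funext.
have lin (k1 k2 k3 : R) : continuous (fun p : R * R => k1 * p.1 + k2 * p.2 + k3).
  move=> p; apply: cvgD; last exact: cvg_cst.
  apply: cvgD; apply: cvgM; try exact: cvg_cst.
    exact: fst_continuous.
  exact: snd_continuous.
by apply: pair_continuous; exact: lin.
Qed.

(** Comparing an interior point with its shifts by [e / 2] along the axes kills both coefficients.
    This excludes bodies of zero diameter or zero width. *)
Lemma nonzero_linear_nonconstant (R : realType) (K : set (R * R)) (k1 k2 m : R) :
  interior K !=set0 -> (forall p, K p -> k1 * p.1 + k2 * p.2 = m) ->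
  k1 = 0 /\ k2 = 0.
Proof.
move=> [[z1 z2] /nbhs_ballP[e /= e0 eK]] Km.
have Kz s t : `|s| < e -> `|t| < e -> k1 * (z1 + s) + k2 * (z2 + t) = m.
  move=> se te; apply: (Km (_, _)); apply: eK.
  by split; rewrite -ball_normE /= opprD addNKr normrN.
have h00 := Kz 0 0; have h10 := Kz (e / 2) 0; have h01 := Kz 0 (e / 2).
rewrite normr0 in h00 h10 h01; rewrite gtr0_norm ?divr_gt0// in h10 h01.
have {}h00 := h00 e0 e0.
have {}h10 : k1 * (z1 + e / 2) + k2 * (z2 + 0) = m by apply: h10; lra.
have {}h01 : k1 * (z1 + 0) + k2 * (z2 + e / 2) = m by apply: h01; lra.
by split; nra.
Qed.

Lemma exists_diametral_pair (R : realType) (K : set (R * R)) :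
  compact K -> K !=set0 -> exists p q, [/\ K p, K q & forall x y, K x -> K y ->
    (x.1 - y.1) ^+ 2 + (x.2 - y.2) ^+ 2 <= (p.1 - q.1) ^+ 2 + (p.2 - q.2) ^+ 2].
Proof.
move=> kK [z Kz].
pose f (u : (R * R) * (R * R)) := (u.1.1 - u.2.1) ^+ 2 + (u.1.2 - u.2.2) ^+ 2.
have cf : continuous f.
  have c11 : continuous (fun u : (R * R) * (R * R) => u.1.1).
    by move=> u; apply: continuous_comp; exact: fst_continuous.
  have c12 : continuous (fun u : (R * R) * (R * R) => u.1.2).
    move=> u; apply: continuous_comp; first exact: fst_continuous.
    exact: snd_continuous.
  have c21 : continuous (fun u : (R * R) * (R * R) => u.2.1).
    move=> u; apply: continuous_comp; first exact: snd_continuous.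
    exact: fst_continuous.
  have c22 : continuous (fun u : (R * R) * (R * R) => u.2.2).
    by move=> u; apply: continuous_comp; exact: snd_continuous.
  move=> u; apply: cvgD; apply: cvgM; apply: cvgB;
    [exact: c11|exact: c21|exact: c11|exact: c21
    |exact: c12|exact: c22|exact: c12|exact: c22].
have KK0 : K `*` K !=set0 by exists (z, z).
have [[p q] /set_mem[/= Kp Kq] pq] :=
  compact_EVT_max KK0 (compact_setX kK kK) (continuous_subspaceT cf).
by exists p, q; split => // x y Kx Ky; exact/(pq (x, y))/mem_set.
Qed.

(* [|x - q| <= |p - q|] and [|x - p| <= |p - q|] put the projection of [x] on the
   line [pq] between [p] and [q]; this gives the strip [0 <= y <= 2]. *)
Lemma affine_normal_position (R : realType) (K : set (R * R)) :
  planar_convex_body K ->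
  exists2 phi, nonsingular_affine phi & exists c a b,
    [/\ (phi @` K) (0, 0), (phi @` K) (0, 2), (phi @` K) (c, a),
        (phi @` K) (c + 1, b) & phi @` K `<=` `[c, c + 1] `*` `[0, 2]].
Proof.
move=> [kK cK intK].
have K0 : K !=set0 by have [z /nbhs_singleton] := intK; exists z.
have [p [q [Kp Kq pqmax]]] := exists_diametral_pair kK K0.
pose d1 := q.1 - p.1; pose d2 := q.2 - p.2.
pose N := d1 ^+ 2 + d2 ^+ 2.
have NE : (p.1 - q.1) ^+ 2 + (p.2 - q.2) ^+ 2 = N by rewrite /N /d1 /d2; ring.
rewrite NE in pqmax.
have : 0 <= N by rewrite addr_ge0 ?sqr_ge0.
rewrite le_eqVlt => /predU1P[N0|N0].
  have [|one0 _] := @nonzero_linear_nonconstant _ K 1 0 p.1 intK.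
    move=> x Kx; have := pqmax _ _ Kx Kp; rewrite -N0 mul1r mul0r addr0 => xp.
    apply/eqP; rewrite -subr_eq0 -sqrf_eq0 eq_le sqr_ge0 andbT.
    by have := sqr_ge0 (x.2 - p.2); lra.
  by move/eqP: one0; rewrite oner_eq0.
(* [v] measures position across [pq], and [u] below position along it; both are scaled by the length
   of [pq]. *)
pose v (x : R * R) := - d2 * x.1 + d1 * x.2.
have cv : continuous v.
  move=> x; apply: cvgD; apply: cvgM; try exact: cvg_cst.
    exact: fst_continuous.
  exact: snd_continuous.
have [x0 /set_mem Kx0 x0min] := compact_EVT_min K0 kK (continuous_subspaceT cv).
have [x1 /set_mem Kx1 x1max] := compact_EVT_max K0 kK (continuous_subspaceT cv).
have {}x0min x : K x -> v x0 <= v x by move=> Kx; exact/x0min/mem_set.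
have {}x1max x : K x -> v x <= v x1 by move=> Kx; exact/x1max/mem_set.
pose w := v x1 - v x0.
have w0 : 0 < w.
  rewrite subr_gt0 lt_neqAle x0min// andbT; apply/negP => /eqP x01.
  have [|d20 d10] := @nonzero_linear_nonconstant _ K (- d2) d1 (v x0) intK.
    by move=> x Kx; apply/eqP; rewrite eq_le -/(v x) x0min// x01 x1max.
  have {}d20 : d2 = 0 by lra.
  by move: N0; rewrite /N d10 d20 expr0n /= addr0 ltxx.
pose u (x : R * R) := d1 * (x.1 - p.1) + d2 * (x.2 - p.2).
(* Since [u p = 0], [u q = N] and [v p = v q], this sends [p] to (0, 0) and [q] to (0, 2), and it
   rescales the width [w] to 1. *)
pose phi (x : R * R) := ((v x - v p) / w, 2 * u x / N).
have phi_affine : nonsingular_affine phi.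
  apply: (@nonsingular_affineP _ (- d2 / w) (d1 / w) (2 * d1 / N) (2 * d2 / N)
    (- v p / w) (- 2 * (d1 * p.1 + d2 * p.2) / N)); last first.
    by move=> x; congr pair; rewrite /v /u; field; lra.
  have -> : - d2 / w * (2 * d2 / N) - d1 / w * (2 * d1 / N) = - (2 / w).
    by rewrite /N; field; rewrite -/N !lt0r_neq0.
  by rewrite oppr_eq0 mulf_neq0 ?invr_eq0// lt0r_neq0.
exists phi => //.
have phi2 x : K x -> 0 <= 2 * u x / N <= 2.
  move=> Kx; rewrite ler_pdivlMr// ler_pdivrMr//.
  have xp := pqmax _ _ Kx Kp; have xq := pqmax _ _ Kx Kq.
  (* With this expansion, [xq] and [xp0] give [0 <= u x], while [xp] and [xq0] give [u x <= N]. *)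
  have xqE : (x.1 - q.1) ^+ 2 + (x.2 - q.2) ^+ 2 =
      (x.1 - p.1) ^+ 2 + (x.2 - p.2) ^+ 2 - 2 * u x + N.
    by rewrite /u /N /d1 /d2; ring.
  have xp0 : 0 <= (x.1 - p.1) ^+ 2 + (x.2 - p.2) ^+ 2.
    by rewrite addr_ge0 ?sqr_ge0.
  have xq0 : 0 <= (x.1 - q.1) ^+ 2 + (x.2 - q.2) ^+ 2.
    by rewrite addr_ge0 ?sqr_ge0.
  by rewrite xqE in xq xq0; apply/andP; split; lra.
have cE : (v x0 - v p) / w + 1 = (v x1 - v p) / w.
  by rewrite -(divff (lt0r_neq0 w0)) -mulrDl; congr (_ / w); rewrite /w; ring.
exists ((v x0 - v p) / w), (2 * u x0 / N), (2 * u x1 / N); split.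
- by exists p => //; rewrite /phi /u !subrr !mulr0 addr0 mulr0 !mul0r.
- exists q => //; congr pair; first by rewrite /v /d1 /d2; field; lra.
  by rewrite [u q](_ : _ = N) ?mulfK ?lt0r_neq0// /u /N /d1 /d2; ring.
- by exists x0.
- by rewrite cE; exists x1.
- move=> _ [x Kx <-]; split; rewrite /= in_itv/=; last exact: phi2.
  by rewrite cE !ler_pM2r ?invr_gt0// !lerD2r x0min// x1max.
Qed.

(** * Comparison of the body with its normalized image *)

Theorem theorem1p7 (R : realType) (K : set (R * R))
  (hK : planar_convex_body K) (hpos : behrend_bisecting_position K) :
  area K / bisecting_diameter K ^+ 2 >= Num.sqrt 3 / 4.
Proof.
have [phi phi_affine [c [a [b [L0 L2 La Lb Lsub]]]]] := affine_normal_position hK.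
have [kK cK _] := hK.
have kL : compact (phi @` K).
  apply: continuous_compact kK; apply: continuous_subspaceT.
  exact: nonsingular_affine_continuous.
have cL := comb_closed_affine_image phi_affine (convex_set_comb cK).
have ratioL := bisecting_ratio_ge kL cL L0 L2 La Lb Lsub.
have ratioK : bisecting_ratio (phi @` K) <= bisecting_ratio K.
  by rewrite -lee_fin hpos; apply: ereal_sup_ubound; exists phi.
(* This puts [Num.sqrt 3 / 4] below the bound [1 / 2] for the image. *)
have sqrt3 : Num.sqrt 3 <= 2 :> R.
  have -> : 2 = Num.sqrt (2 ^+ 2) :> R by rewrite sqrtr_sqr ger0_norm.
  by rewrite ler_wsqrtr//; lra.
by move: ratioL ratioK; rewrite /bisecting_ratio; lra.
Qed.
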